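(* Let $\lambda_s\in\mathbb{C}$, $a_s\in\mathbb{Z}$ and $n_s\in\mathbb{Z}^+$ for $s=1,\ldots,k$. Then the smallest positive period $n_0$ of the function $w:\mathbb{Z}\to\mathbb{C}$, $$w(x)=\sum_{s=1}^k\lambda_s[\![n_s\mid x-a_s]\!],$$ is the least $n\in\mathbb{Z}^+$ such that $\alpha n\in\mathbb{Z}$ for all those real $\alpha\in[0,1)$ with $$\sum_{\substack{1\le s\le k\\ \alpha n_s\in\mathbb{Z}}}\frac{\lambda_s}{n_s}e^{2\pi i\alpha a_s}\neq 0.$$
   Context: $\mathbb{Z}^+=\{1,2,3,\ldots\}$. For an assertion $P$, $[\![P]\!]=1$ if $P$ holds and $[\![P]\!]=0$ otherwise. A positive period of $w$ is an $n\in\mathbb{Z}^+$ with $w(x+n)=w(x)$ for all $x\in\mathbb{Z}$. An empty sum is $0$. *)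

(* Defs.v *)
From mathcomp Require Import all_boot all_order all_algebra.
From mathcomp Require Import all_classical all_reals all_analysis.
From mathcomp Require Import complex.

Set Implicit Arguments.
Unset Strict Implicit.
Unset Printing Implicit Defensive.

Import Order.TTheory GRing.Theory Num.Theory.

Local Open Scope ring_scope.
Local Open Scope complex_scope.

Definition cexp (R : realType) (z : R[i]) : R[i] :=
  let: x +i* y := z in (expR x)%:C * (cos y +i* sin y).

Definition least_nat (P : nat -> Prop) (n : nat) : Prop :=
  P n /\ forall m : nat, P m -> (n <= m)%N.

Definition positive_period (V : zmodType) (w : int -> V) (n : nat) : Prop :=
  (0 < n)%N /\ periodic w n%:Z.

Definition residue_sum (R : realType) (k : nat) (lambda : 'I_k -> R[i])
    (a : 'I_k -> int) (n : 'I_k -> nat) (x : int) : R[i] :=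
  \sum_(s < k) lambda s * ((n s)%:Z %| x - a s)%Z%:R.

(* ['i%C] is [0 +i* 1], on which [cexp] computes; in [ring_scope] ['i] would be
   [Num.imaginary] instead. *)
Definition frequency_sum (R : realType) (k : nat) (lambda : 'I_k -> R[i])
    (a : 'I_k -> int) (n : 'I_k -> nat) (alpha : R) : R[i] :=
  \sum_(s < k | alpha * (n s)%:R \is a Num.int)
    lambda s / (n s)%:R * cexp (2 * pi%:C * 'i%C * alpha%:C * (a s)%:~R).

(* Main.v *)
Require Import Defs.
From mathcomp Require Import all_boot all_order all_algebra.
From mathcomp Require Import all_classical all_reals all_analysis.
From mathcomp Require Import complex lra.

Import Order.TTheory GRing.Theory Num.Theory.

Local Open Scope ring_scope.
Local Open Scope complex_scope.

(** The theorem is Fourier analysis on a cyclic group.  Write e(theta) for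
    exp(2 pi i theta) and F(alpha) for the frequency sum at alpha.  The
    indicator of n | y is the average of e(j y / n) over j < n, and the
    frequencies j / n with 0 <= j < n are exactly the alpha in [0, 1) with
    alpha n an integer.  Summing over s, one gets
      w(x) = sum of F(alpha) e(- alpha x),
    where alpha may be taken to run over all r / N with 0 <= r < N, for N any
    common multiple of the moduli ([residue_sum_fourier]).

    If alpha m is an integer whenever F(alpha) <> 0, then each term of the
    expansion is unchanged when x becomes x + m, so m is a period.  Conversely,
    if m is a period, then
      sum of F(alpha) (e(- alpha m) - 1) e(- alpha x) = 0 for every x,
    and the orthogonality of the characters x |-> e(- alpha x) on Z / N kills
    every coefficient ([fourier_coef_eq0]); so e(- alpha m) = 1, that is,
    alpha m is an integer, as soon as F(alpha) <> 0.

    Hence the periods of w and the m that clear all the denominators of the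
    active frequencies are the same positive integers
    ([positive_period_residue_sum]); N is one of them, and both sets have the
    same least element. *)

(** * The character exp(2 pi i theta) of the reals *)

Definition circle_exp {R : realType} (theta : R) : R[i] :=
  cos (2 * pi * theta) +i* sin (2 * pi * theta).

Lemma cexp_circle_exp (R : realType) (alpha : R) (b : int) :
  cexp (2 * pi%:C * 'i%C * alpha%:C * b%:~R) = circle_exp (alpha * b%:~R).
Proof.
have -> : 2 * pi%:C * 'i%C * alpha%:C * b%:~R =
          0 +i* (2 * pi * (alpha * b%:~R)) :> R[i].
  rewrite -(rmorph_int (real_complex R)) -(rmorph_nat (real_complex R) 2).
  by apply/eqP; rewrite eq_complex /= !(mul0r, mulr0, mulr1, add0r, addr0,
    subr0, sub0r, oppr0) eqxx mulrA eqxx.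
by rewrite /cexp expR0 mul1r.
Qed.

Lemma circle_exp0 (R : realType) : circle_exp (0 : R) = 1.
Proof. by rewrite /circle_exp mulr0 cos0 sin0. Qed.

Lemma circle_expD (R : realType) (s t : R) :
  circle_exp (s + t) = circle_exp s * circle_exp t.
Proof.
rewrite /circle_exp mulrDr cosD sinD.
by apply/eqP; rewrite eq_complex /= eqxx addrC eqxx.
Qed.

Lemma circle_exp_nat (R : realType) (t : R) (n : nat) :
  circle_exp (n%:R * t) = circle_exp t ^+ n.
Proof.
elim: n => [|n IHn]; first by rewrite mul0r circle_exp0.
by rewrite exprS -natr1 addrC mulrDl mul1r circle_expD IHn.
Qed.

Lemma circle_exp_int (R : realType) (z : int) : circle_exp (z%:~R : R) = 1.
Proof.
have circle_exp_natr (n : nat) : circle_exp (n%:R : R) = 1.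
  rewrite -[n%:R]mulr1 circle_exp_nat /circle_exp mulr1 mulr_natl.
  by rewrite cos2pi sin2pi expr1n.
case: z => n; first exact: circle_exp_natr.
have := circle_expD R (Negz n)%:~R n.+1%:R.
by rewrite NegzE mulrNz addNr circle_exp0 circle_exp_natr mulr1.
Qed.

(** Modulo 1 one may take t in [0, 1).  Then e(t) = 1 makes the cosine of
    2 pi t equal to 1, so the sine of pi t vanishes, whereas the sine is
    positive on the open interval from 0 to pi. *)
Lemma circle_exp_eq1 (R : realType) (t : R) :
  (circle_exp t == 1) = (t \is a Num.int).
Proof.
apply/idP/idP => [|/intrP[z ->]]; last by rewrite circle_exp_int.
rewrite -[t](subrK (Num.floor t)%:~R) circle_expD circle_exp_int mulr1.
set u := t - _; have /andP[u_ge0 u_lt1] : 0 <= u < 1.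
  have /andP[le_t lt_t] := floor_itv t.
  by rewrite subr_ge0 le_t ltrBlDl -intrD1.
rewrite eq_complex => /andP[/eqP/= cosu _].
have [->|u_neq0] := eqVneq u 0; first by rewrite add0r intr_int.
have sinu : 0 < sin (pi * u).
  have u_gt0 : 0 < u by rewrite lt_def u_neq0.
  by rewrite sin_gt0_pi// mulr_gt0 ?pi_gt0//= gtr_pMr ?pi_gt0.
move: cosu; rewrite -mulrA mulr_natl cos_mulr2n cos2sin2 => cosu.
have : sin (pi * u) ^+ 2 = 0 by lra.
by move/eqP; rewrite sqrf_eq0 gt_eqF.
Qed.

(** * Orthogonality and the Fourier expansion *)

Lemma intr_div_nat_int (R : archiRealFieldType) (n : nat) (y : int) :
  (0 < n)%N -> (y%:~R / n%:R \is a @Num.int R) = (n%:Z %| y)%Z.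
Proof.
move=> n_gt0; have n_neq0 : n%:R != 0 :> R by rewrite pnatr_eq0 -lt0n.
apply/intrP/dvdzP => -[z]; last by move=> ->; exists z; rewrite intrM mulfK.
move/(canRL (mulfVK n_neq0)) => yE; exists z; apply/eqP.
by rewrite -(eqr_int R) yE intrM.
Qed.

(** A geometric sum whose ratio e(y / n) is an n-th root of unity, equal to 1
    exactly when n divides y. *)
Lemma sum_circle_exp (R : realType) (n : nat) (y : int) : (0 < n)%N ->
  \sum_(j < n) circle_exp (j%:R / n%:R * y%:~R : R) =
    n%:R * (n%:Z %| y)%Z%:R.
Proof.
move=> n_gt0; pose z := circle_exp (y%:~R / n%:R : R).
have -> : \sum_(j < n) circle_exp (j%:R / n%:R * y%:~R : R) =
          \sum_(j < n) z ^+ j.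
  by apply: eq_bigr => j _; rewrite -circle_exp_nat mulrAC mulrA.
rewrite -(intr_div_nat_int R)// -circle_exp_eq1 -/z.
have [->|z_neq1] := eqVneq z 1.
  under eq_bigr do rewrite expr1n.
  by rewrite sumr_const card_ord mulr1.
have z_expn : z ^+ n = 1.
  rewrite -circle_exp_nat mulrC divfK ?circle_exp_int//.
  by rewrite pnatr_eq0 -lt0n.
move/eqP: (subrX1 z n); rewrite z_expn subrr eq_sym mulf_eq0 subr_eq0.
by rewrite (negPf z_neq1) mulr0 => /eqP.
Qed.

(** When n divides N, the r / N with r < N whose product with n is an integer
    are the j / n with j < n.  Reading the previous sum over the finer grid
    makes the sums for the various moduli n s range over the same
    frequencies. *)
Lemma sum_circle_exp_dvd (R : realType) (n N : nat) (y : int) :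
  (0 < N)%N -> (n %| N)%N ->
  \sum_(r < N | (r%:R / N%:R : R) * n%:R \is a Num.int)
    circle_exp (r%:R / N%:R * y%:~R : R) = n%:R * (n%:Z %| y)%Z%:R.
Proof.
move=> N_gt0 /dvdnP[q NE]; move: N_gt0; rewrite {}NE muln_gt0.
move=> /andP[q_gt0 n_gt0]; rewrite -(sum_circle_exp R)//.
have n_neq0 : n%:R != 0 :> R by rewrite pnatr_eq0 -lt0n.
have q_neq0 : q%:R != 0 :> R by rewrite pnatr_eq0 -lt0n.
have intE (r : nat) :
    ((r%:R / (q * n)%:R : R) * n%:R \is a Num.int) = (q %| r)%N.
  rewrite natrM invfM mulrA mulfVK//.
  exact: (intr_div_nat_int R q r).
have lt_scale (j : 'I_n) : (q * j < q * n)%N by rewrite ltn_pmul2l.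
have lt_quo (r : 'I_(q * n)) : (r %/ q < n)%N.
  by rewrite ltn_divLR// [(n * _)%N]mulnC.
rewrite (reindex_onto (fun j => Ordinal (lt_scale j))
                      (fun r => Ordinal (lt_quo r))) /=; last first.
  by move=> r; rewrite intE => q_dvd_r; apply: val_inj; rewrite /= mulnC divnK.
apply: eq_big => [j|j _]; last first.
  by rewrite !natrM -mulf_div divff// mul1r.
by rewrite intE dvdn_mulr//; apply/eqP/val_inj; rewrite /= mulKn.
Qed.

(** Each indicator is expanded by itself; exchanging the sums over s and r
    collects, at the frequency r / N, exactly the s with (r / N) n s an
    integer, which is the range of the frequency sum. *)
Lemma residue_sum_fourier (R : realType) (k : nat) (lambda : 'I_k -> R[i])
    (a : 'I_k -> int) (n : 'I_k -> nat) (N : nat) (x : int) :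
  (0 < N)%N -> (forall s, n s %| N)%N ->
  residue_sum lambda a n x =
    \sum_(r < N) frequency_sum lambda a n (r%:R / N%:R)
                 * circle_exp (- (r%:R / N%:R * x%:~R)).
Proof.
move=> N_gt0 n_dvd.
under eq_bigr do rewrite /frequency_sum mulr_suml big_mkcond /=.
rewrite exchange_big /=; apply: eq_bigr => s _.
rewrite -big_mkcond /=.
have ns_neq0 : (n s)%:R != 0 :> R[i].
  by rewrite pnatr_eq0 -lt0n (dvdn_gt0 N_gt0).
(* Dividing the character sum at a s - x by n s gives the indicator. *)
have := sum_circle_exp_dvd R (n s) N (a s - x) N_gt0 (n_dvd s).
move/(congr1 ( *%R (lambda s / (n s)%:R))).
rewrite mulrA divfK// -[(_ %| a s - x)%Z]rpredN opprB => <-.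
rewrite mulr_sumr; apply: eq_bigr => r _.
by rewrite cexp_circle_exp -[RHS]mulrA -circle_expD intrB mulrBr.
Qed.

Lemma fourier_coef_eq0 (R : realType) (N : nat) (c : 'I_N -> R[i]) :
  (forall x : int,
     \sum_(r < N) c r * circle_exp (- (r%:R / N%:R * x%:~R) : R) = 0) ->
  forall t : 'I_N, c t = 0.
Proof.
move=> c_eq0 t; have N_gt0 : (0 < N)%N by case: t => /= m; apply: leq_ltn_trans.
have N_neq0 : N%:R != 0 :> R[i] by rewrite pnatr_eq0 -lt0n.
apply: (mulIf N_neq0); rewrite mul0r.
(* Pairing the vanishing sum with the character of frequency t / N isolates
   the coefficient c t, with the factor N. *)
have : \sum_(x < N) circle_exp (t%:R / N%:R * x%:R : R) *
    (\sum_(r < N) c r * circle_exp (- (r%:R / N%:R * x%:Z%:~R) : R)) = 0.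
  by apply: big1 => x _; rewrite c_eq0 mulr0.
under eq_bigr do rewrite mulr_sumr.
rewrite exchange_big /= => <-; apply/esym.
have inner (r : 'I_N) :
    \sum_(x < N) circle_exp (t%:R / N%:R * x%:R : R) *
      (c r * circle_exp (- (r%:R / N%:R * x%:Z%:~R) : R)) =
    c r * (N%:R * (r == t)%:R).
  transitivity (c r * (N%:R * (N%:Z %| t%:Z - r%:Z)%Z%:R)).
    rewrite -(sum_circle_exp R)// mulr_sumr; apply: eq_bigr => x _.
    rewrite mulrCA -circle_expD; congr (_ * circle_exp _).
    by rewrite intrB mulrBr; congr (_ - _); rewrite mulrAC [RHS]mulrAC;
      congr (_ / _); rewrite mulrC.
  congr (_ * (_ * (nat_of_bool _)%:R)).
  by rewrite -eqz_mod_dvd !modz_nat eqz_nat !modn_small// eq_sym.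
under eq_bigr do rewrite inner.
rewrite (bigD1 t)//= eqxx mulr1 big1 ?addr0// => r r_neq.
by rewrite (negPf r_neq) !mulr0.
Qed.

(** * Periods and frequencies *)

Lemma frequency_sum_neq0 (R : realType) (k : nat) (lambda : 'I_k -> R[i])
    (a : 'I_k -> int) (n : 'I_k -> nat) (N : nat) (alpha : R) :
  (forall s, n s %| N)%N ->
  frequency_sum lambda a n alpha <> 0 -> alpha * N%:R \is a Num.int.
Proof.
move=> n_dvd F_neq0.
have [s alpha_ns] : exists s, alpha * (n s)%:R \is a Num.int.
  apply: contra_notP F_neq0 => no_s; apply: big1 => s alpha_ns.
  by case: no_s; exists s.
have /dvdnP[q ->] := n_dvd s.
by rewrite natrM mulrCA rpredM// natr_int.
Qed.

(** Translating w by m multiplies its Fourier coefficient at r / N by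
    e(- r m / N), so by uniqueness of the coefficients w is unchanged exactly
    when this factor is 1 wherever the coefficient does not vanish. *)
Lemma periodic_residue_sum_grid (R : realType) (k : nat)
    (lambda : 'I_k -> R[i]) (a : 'I_k -> int) (n : 'I_k -> nat) (N m : nat) :
  (0 < N)%N -> (forall s, n s %| N)%N ->
  periodic (residue_sum lambda a n) m%:Z <->
  (forall r : 'I_N, frequency_sum lambda a n (r%:R / N%:R) <> 0 ->
     (r%:R / N%:R : R) * m%:R \is a Num.int).
Proof.
move=> N_gt0 n_dvd; pose F (r : nat) := frequency_sum lambda a n (r%:R / N%:R).
pose shift (r : nat) := circle_exp (- (r%:R / N%:R * m%:R) : R).
have fourier x := residue_sum_fourier R k lambda a n N x N_gt0 n_dvd.
have shift_eq1 r : (shift r == 1) = ((r%:R / N%:R : R) * m%:R \is a Num.int).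
  by rewrite circle_exp_eq1 rpredN.
have fourierD x : residue_sum lambda a n (x + m%:Z) =
    \sum_(r < N) F r * shift r * circle_exp (- (r%:R / N%:R * x%:~R) : R).
  rewrite fourier; apply: eq_bigr => r _; rewrite -[RHS]mulrA -circle_expD.
  by rewrite intrD mulrDr opprD [- _ - _]addrC.
split=> [per r F_neq0|int_freq x]; last first.
  rewrite fourierD fourier; apply: eq_bigr => r _; congr (_ * _).
  have [F0|/eqP F_neq0] := eqVneq (F r) 0; first by rewrite F0 mul0r -/(F r) F0.
  by have /eqP -> : shift r == 1; rewrite ?mulr1// shift_eq1; apply: int_freq.
have coef_eq0 : forall t : 'I_N, F t * (shift t - 1) = 0.
  apply: fourier_coef_eq0 => x.
  rewrite -[RHS](subrr (residue_sum lambda a n x)) -{1}per.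
  rewrite fourierD fourier -sumrB; apply: eq_bigr => i _.
  by rewrite mulrBr mulr1 mulrBl.
move/eqP: (coef_eq0 r); rewrite mulf_eq0 subr_eq0 shift_eq1.
by case/orP => // /eqP/F_neq0.
Qed.

Lemma positive_period_residue_sum (R : realType) (k : nat)
    (lambda : 'I_k -> R[i]) (a : 'I_k -> int) (n : 'I_k -> nat) (N m : nat) :
  (0 < N)%N -> (forall s, n s %| N)%N ->
  positive_period (residue_sum lambda a n) m <->
  (0 < m)%N /\ forall alpha : R, 0 <= alpha < 1 ->
    frequency_sum lambda a n alpha <> 0 -> alpha * m%:R \is a Num.int.
Proof.
move=> N_gt0 n_dvd.
have N_gt0R : 0 < N%:R :> R by rewrite ltr0n.
rewrite /positive_period (periodic_residue_sum_grid R k lambda a n N m)//.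
split=> -[m_gt0 int_freq]; split=> //.
  move=> alpha /andP[alpha_ge0 alpha_lt1] F_neq0.
  (* An active frequency has denominator dividing N: it lies on the grid. *)
  have /intrP[z alphaN] :=
    frequency_sum_neq0 R k lambda a n N alpha n_dvd F_neq0.
  have z_ge0 : 0 <= z.
    by rewrite -(ler0z R) -alphaN mulr_ge0// ltW.
  case: z z_ge0 alphaN => // r _ alphaN.
  have alphaE : alpha = r%:R / N%:R.
    by apply: (canRL (mulfK _) alphaN); rewrite gt_eqF.
  have r_lt : (r < N)%N.
    by rewrite -(ltr_nat R) -[r%:R]alphaN gtr_pMl.
  by rewrite alphaE; apply: (int_freq (Ordinal r_lt)); rewrite /= -alphaE.
move=> r; apply: int_freq.
by rewrite divr_ge0//= ltr_pdivrMr// mul1r ltr_nat.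
Qed.

Theorem theorem1p3 (R : realType) (k : nat) (lambda : 'I_k -> R[i])
    (a : 'I_k -> int) (n : 'I_k -> nat) (n_gt0 : forall s : 'I_k, (0 < n s)%N) :
  exists n0 : nat,
    least_nat (positive_period (residue_sum lambda a n)) n0 /\
    least_nat (fun m : nat => (0 < m)%N /\
      forall alpha : R, 0 <= alpha < 1 -> frequency_sum lambda a n alpha <> 0 ->
        alpha * m%:R \is a Num.int) n0.
Proof.
pose N := (\prod_(s < k) n s)%N.
have N_gt0 : (0 < N)%N by apply: prodn_gt0.
have n_dvd s : (n s %| N)%N by rewrite /N (bigD1 s)//= dvdn_mulr.
have periodE m := positive_period_residue_sum R k lambda a n N m N_gt0 n_dvd.
pose P (m : nat) := `[< positive_period (residue_sum lambda a n) m >].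
have exP : exists m, P m.
  exists N; apply/asboolP/periodE; split=> // alpha _.
  exact: frequency_sum_neq0.
case: (ex_minnP exP) => n0 /asboolP per_n0 min_n0.
exists n0; split; split=> //.
- by move=> m /asboolP; apply: min_n0.
- exact/periodE.
- by move=> m /periodE/asboolP; apply: min_n0.
Qed.
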